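(* Let $n,k$ be integers with $1\le k\le n-1$ and let $G\in\mathbb{E}_n^k$, i.e. $G$ is a connected simple graph with $n$ vertices and edge connectivity $\kappa'(G)\le k$. Then $$\prod\nolimits_1(G)\ge (n-1)^2\quad\text{and}\quad \prod\nolimits_2(G)\ge 4^{n-2},$$ where equality holds in the first inequality if and only if $G\cong S_n$, and in the second if and only if $G\cong P_n$.
   Context: All graphs are finite, simple and connected. $d(u)$ is the degree of a vertex $u$. The first and second multiplicative Zagreb indices are $\prod_1(G)=\prod_{u\in V(G)}d(u)^2$ and $\prod_2(G)=\prod_{uv\in E(G)}d(u)d(v)=\prod_{u\in V(G)}d(u)^{d(u)}$. A graph is $k$-edge-connected ($k\ge1$) if it has at least two vertices and has no edge cut of size $k-1$; $\kappa'(G)$ is the largest $k$ for which $G$ is $k$-edge-connected. $\mathbb{E}_n^k$ is the set of connected graphs with $n$ vertices and $\kappa'(G)\le k\le n-1$. $P_n$ and $S_n$ denote the path and the star on $n$ vertices. *)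

(* Defs.v *)
From mathcomp Require Import all_boot.

Set Implicit Arguments.
Unset Strict Implicit.
Unset Printing Implicit Defensive.

Record sgraph := SGraph {
  vertex :> finType;
  adj : rel vertex;
  adj_sym : symmetric adj;
  adj_irrefl : irreflexive adj
}.
Arguments adj {s}.

Section Graph.
Variable G : sgraph.
Implicit Types (u v x y : G) (F : {set {set G}}).

Definition deg u : nat := #|[set v | adj u v]|.

(* An edge uv is the two-element set [set u; v]. *)
Definition edges : {set {set G}} :=
  [set [set p.1; p.2] | p : G * G & adj p.1 p.2].

Definition connected_graph : bool := [forall x, forall y, connect (@adj G) x y].

Definition zagreb1 : nat := \prod_(u : G) deg u ^ 2.

Definition zagreb2 : nat := \prod_(e in edges) \prod_(u in e) deg u.

Lemma mem_edges x y : ([set x; y] \in edges) = adj x y.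
Proof.
apply/imsetP/idP => [[[a b] /=]|xy]; last by exists (x, y); rewrite ?inE.
rewrite inE /= => ab eqE.
have aNb : a != b by apply: contraTneq ab => ->; rewrite adj_irrefl.
have : a \in [set x; y] by rewrite eqE set21.
have : b \in [set x; y] by rewrite eqE set22.
rewrite !inE => /orP[]/eqP bE /orP[]/eqP aE; subst=> //;
  by rewrite ?eqxx // adj_sym in aNb ab *.
Qed.

Lemma edgesP (e : {set G}) :
  reflect (exists x y, adj x y /\ e = [set x; y]) (e \in edges).
Proof.
apply: (iffP idP) => [/imsetP[[x y]]|[x [y [xy ->]]]]; last by rewrite mem_edges.
by rewrite inE /= => xy ->; exists x, y.
Qed.

Lemma deg_edges u : deg u = #|[set e in edges | u \in e]|.
Proof.
rewrite /deg -(@card_in_imset _ _ (fun v => [set u; v])); last first.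
  move=> v w; rewrite !inE => uv uw /setP/(_ v).
  rewrite !inE eqxx orbT; case: eqP => [vu|_ /esym/eqP //].
  by rewrite vu adj_irrefl in uv.
apply: eq_card => e; rewrite inE; apply/imsetP/andP => [[v]|].
  by rewrite inE => uv ->; rewrite mem_edges set21.
case=> /edgesP[x [y [xy ->]]]; rewrite !inE => /orP[]/eqP->.
  by exists y; rewrite ?inE.
by exists x; rewrite ?inE 1?adj_sym // setUC.
Qed.

Lemma zagreb2E : zagreb2 = \prod_(u : G) deg u ^ deg u.
Proof.
rewrite /zagreb2 (exchange_big_dep predT) //=; apply: eq_bigr => u _.
rewrite prod_nat_const; congr (_ ^ _); rewrite [RHS]deg_edges.
by apply: eq_card => e; rewrite !inE.
Qed.

End Graph.

Section EdgeDeletion.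
Variables (G : sgraph) (F : {set {set G}}).

Definition del_adj : rel G := [rel x y | adj x y && ([set x; y] \notin F)].

Lemma del_adj_sym : symmetric del_adj.
Proof. by move=> x y; rewrite /del_adj /= adj_sym setUC. Qed.

Lemma del_adj_irrefl : irreflexive del_adj.
Proof. by move=> x; rewrite /del_adj /= adj_irrefl. Qed.

Definition del_edges : sgraph := SGraph del_adj_sym del_adj_irrefl.

End EdgeDeletion.

Section EdgeConnectivity.
Variable G : sgraph.

Definition edge_cut (F : {set {set G}}) : bool :=
  (F \subset edges G) && ~~ connected_graph (del_edges F).

(* "No edge cut of size k - 1" has to mean "no edge cut with at most k - 1
   edges": read literally it holds vacuously once k - 1 > #|edges G|, and there
   would be no largest k.  For k - 1 <= #|edges G| the two readings agree, see
   k_edge_connectedE. *)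
Definition k_edge_connected (k : nat) : bool :=
  (1 < #|G|) && [forall F : {set {set G}}, edge_cut F ==> (k <= #|F|)].

(* The range of the maximum loses nothing, see k_edge_connected_leq. *)
Definition edge_connectivity : nat :=
  \max_(k < #|edges G|.+1 | k_edge_connected k) k.

Lemma edge_cutS (F F' : {set {set G}}) :
  edge_cut F -> F \subset F' -> F' \subset edges G -> edge_cut F'.
Proof.
move=> /andP[_ dF] sFF' sF'; rewrite /edge_cut sF'; apply: contra dF.
move=> /forallP cF'; apply/forallP => x; apply/forallP => y.
move: (cF' x) => /forallP/(_ y); apply: connect_sub => a b /= /andP[ab abF'].
by apply/connect1/andP; split=> //; apply: contra abF'; apply: (subsetP sFF').
Qed.

Lemma k_edge_connectedE k : 0 < k <= #|edges G|.+1 ->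
  k_edge_connected k =
  (1 < #|G|) && [forall F : {set {set G}}, edge_cut F ==> (#|F| != k.-1)].
Proof.
case: k => // k /=; rewrite ltnS => kE; congr (_ && _).
apply/forallP/forallP => H F; apply/implyP => cF.
  by have /implyP/(_ cF) := H F; case: ltngtP.
have sF : F \subset edges G by case/andP: cF.
rewrite ltnNge; apply/negP => Fk.
suff [F' /andP[sFF' sF'] cardF'] :
    exists2 F' : {set {set G}}, (F \subset F') && (F' \subset edges G)
      & #|F'| = k.
  have /implyP := H F'; rewrite cardF' eqxx.
  by move/(_ (edge_cutS cF sFF' sF')).
have kD : k - #|F| <= #|edges G :\: F|.
  by rewrite cardsD (setIidPr sF) leq_sub2r.
have [A sA cA] : exists2 A : {set {set G}},
    A \subset edges G :\: F & #|A| = k - #|F|.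
  exists [set x in take (k - #|F|) (enum (edges G :\: F))].
    apply/subsetP => x; rewrite inE => /mem_take.
    by rewrite mem_enum.
  rewrite cardsE (card_uniqP _) ?take_uniq ?enum_uniq //.
  by rewrite size_takel -?cardE.
exists (F :|: A).
  rewrite subsetUl subUset sF; apply: subset_trans sA _; exact: subsetDl.
rewrite cardsU cA; have /eqP -> : F :&: A == set0.
  rewrite setI_eq0 disjoint_sym.
  by move: sA; rewrite subsetD => /andP[].
by rewrite cards0 subn0 subnKC.
Qed.

Lemma k_edge_connected_leq k :
  k_edge_connected k = (1 < #|G|) && (k <= edge_connectivity).
Proof.
rewrite /edge_connectivity; have [G1|G1] /= := boolP (1 < #|G|); last first.
  by rewrite /k_edge_connected (negbTE G1).
have antit i j : i <= j -> k_edge_connected j -> k_edge_connected i.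
  move=> ij; rewrite /k_edge_connected G1 /= => /forallP H; apply/forallP => F.
  by apply/implyP => /(implyP (H F)); apply: leq_trans.
have allcut : edge_cut (edges G).
  rewrite /edge_cut subxx /=; have /card_gt1P[x [y [_ _ xy]]] := G1.
  apply: contra xy => /forallP/(_ x)/forallP/(_ y)/connectP[[|z p] /=].
    by move=> _ ->.
  by rewrite /del_adj /= mem_edges andbN.
apply/idP/idP => [kk|].
  have kE : k < #|edges G|.+1.
    by rewrite ltnS; case/andP: kk => _ /forallP/(_ (edges G))/implyP; exact.
  exact: (@leq_bigmax_cond _ _ (fun i : 'I_ _ => val i) (Ordinal kE)).
have k0 : k_edge_connected (@ord0 #|edges G|).
  by rewrite /k_edge_connected G1; apply/forallP => F; rewrite implybT.
move=> le_k; apply: antit le_k _.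
rewrite (bigop.bigmax_eq_arg ord0) //.
by case: arg_maxnP.
Qed.

End EdgeConnectivity.

Definition Enk (n k : nat) (G : sgraph) : Prop :=
  [/\ connected_graph G, #|G| = n, edge_connectivity G <= k & k <= n - 1].

Definition graph_iso (G H : sgraph) : Prop :=
  exists2 f : G -> H, bijective f & forall x y, adj (f x) (f y) = adj x y.

Definition path_adj n : rel 'I_n := [rel i j : 'I_n | (i.+1 == j) || (j.+1 == i)].

Lemma path_adj_sym n : symmetric (@path_adj n).
Proof. by move=> i j; rewrite /path_adj /= orbC. Qed.

Lemma path_adj_irrefl n : irreflexive (@path_adj n).
Proof. by move=> i; rewrite /path_adj /= orbb gtn_eqF. Qed.

Definition path_graph n : sgraph :=
  SGraph (@path_adj_sym n) (@path_adj_irrefl n).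

(* Vertex 0 is the centre. *)
Definition star_adj n : rel 'I_n :=
  [rel i j : 'I_n | (i == 0 :> nat) != (j == 0 :> nat)].

Lemma star_adj_sym n : symmetric (@star_adj n).
Proof. by move=> i j; rewrite /star_adj /= eq_sym. Qed.

Lemma star_adj_irrefl n : irreflexive (@star_adj n).
Proof. by move=> i; rewrite /star_adj /= eqxx. Qed.

Definition star_graph n : sgraph :=
  SGraph (@star_adj_sym n) (@star_adj_irrefl n).

(* Main.v *)
(* In a connected graph the degrees sum to at least [2 (n - 1)].  Writing each
   degree as [1 + x], the bound on the first index is [prod (1 + x) >= 1 + sum x],
   which is strict as soon as two of the [x] are positive; so in the case of
   equality all vertices but one are leaves.  For the second index,
   [d ^ d >= 4 ^ (d - 1)] with equality only for [d = 1, 2]; so in the case of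
   equality the maximum degree is at most 2, which allows a path to be extended
   until it is Hamiltonian, and the degree sum leaves room for no further edge. *)
Require Import Defs.
From mathcomp Require Import all_boot zify.

Set Implicit Arguments.
Unset Strict Implicit.
Unset Printing Implicit Defensive.

(** * Elementary inequalities for sums, products and powers *)

Lemma sum_lt_prod_succ (I : finType) (P : pred I) (x : I -> nat) :
  \sum_(i | P i) x i < \prod_(i | P i) (x i).+1.
Proof. by elim/big_rec2: _ => // i s p _; nia. Qed.

(** With the factor at [a] split off, the product is at least [(x a + 1) * (s + 1)], where [s] is
    the sum over the other indices. The cross term [x a * s] makes the bound strict, since
    [s >= x b > 0]. *)
Lemma sum_succ_lt_prod_succ (I : finType) (x : I -> nat) a b :
  a != b -> 0 < x a -> 0 < x b ->
  (\sum_i x i).+1 < \prod_i (x i).+1.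
Proof.
move=> ab xa xb; rewrite (bigD1 a) //= [X in _ < X](bigD1 a) //=.
have := sum_lt_prod_succ (fun i => i != a) x.
have : x b <= \sum_(i | i != a) x i by rewrite (bigD1 b) 1?eq_sym // leq_addr.
by nia.
Qed.

Lemma expn4_leq_expnn d : 0 < d -> 4 ^ d.-1 <= d ^ d ?= iff (d <= 2).
Proof.
(* The cases up to 3 are computed, with 16 < 27 at 3. From 4 on, the chain is
   [4 ^ d.-1 < 4 ^ d <= d ^ d]. *)
case: d => [|[|[|[|d]]]] // _; apply/leqifP => //=.
apply: (@leq_trans (4 ^ d.+4)); first by rewrite ltn_exp2l.
by rewrite leq_exp2r.
Qed.

Lemma exists_notin (T : finType) (S : {set T}) :
  #|S| < #|T| -> exists y, y \notin S.
Proof.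
move=> ltST; apply/existsP; rewrite -negb_forall; apply: contraL ltST.
move=> /forallP allS; rewrite -leqNgt.
by apply/subset_leq_card/subsetP => y _; apply: allS.
Qed.

(** * Isomorphisms and degrees *)

Section Isomorphism.
Variables (G H : sgraph) (f : G -> H).
Hypotheses (f_bij : bijective f) (f_adj : forall x y, adj (f x) (f y) = adj x y).

Lemma deg_iso x : deg (f x) = deg x.
Proof.
rewrite /deg -(card_imset _ (bij_inj f_bij)); apply: eq_card => y.
have [g fK gK] := f_bij.
apply/idP/imsetP => [|[z]]; last by rewrite !inE => xz ->; rewrite f_adj.
by rewrite inE -{1}[y]gK f_adj => xz; exists (g y); rewrite ?inE ?gK.
Qed.

End Isomorphism.

(** An edge-preserving bijection embeds each neighbourhood of [H] into one of [G], so no degree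
    decreases. The bound on the degree sums then makes all degrees agree, every such embedding is
    onto, and [G] has no extra edge. *)
Lemma bij_hom_sum_deg (G H : sgraph) (f : H -> G) :
  bijective f -> (forall x y, adj x y -> adj (f x) (f y)) ->
  \sum_(x : G) deg x <= \sum_(x : H) deg x ->
  forall x y, adj (f x) (f y) = adj x y.
Proof.
move=> f_bij f_hom; rewrite (reindex f) /=; last exact: onW_bij.
have f_inj := bij_inj f_bij.
have sN x : f @: [set y | adj x y] \subset [set y | adj (f x) y].
  by apply/subsetP => _ /imsetP[y + ->]; rewrite !inE; apply: f_hom.
have le_deg x : deg x <= deg (f x) ?= iff (deg x == deg (f x)).
  by split=> //; rewrite /deg -(card_imset _ f_inj) subset_leq_card.
have := leqif_sum (fun x (_ : predT x) => le_deg x).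
move=> /= [le_sum eq_sum] ge_sum.
move: eq_sum; rewrite eqn_leq le_sum ge_sum => /esym/forallP deg_eq x y.
have /implyP/(_ isT)/eqP dx := deg_eq x.
have /eqP/setP/(_ (f y)) :
    f @: [set y | adj x y] == [set y | adj (f x) y].
  by rewrite eqEcard sN card_imset // -/(deg (f x)) -dx /=.
by rewrite mem_imset // !inE.
Qed.

Lemma graph_iso_sym (G H : sgraph) : graph_iso G H -> graph_iso H G.
Proof.
move=> [f [g fK gK] f_adj]; exists g; first by exists f.
by move=> x y; rewrite -f_adj !gK.
Qed.

Lemma nth_bij (T : finType) (x0 : T) (s : seq T) :
  uniq s -> size s = #|T| -> bijective (fun i : 'I_#|T| => nth x0 s i).
Proof.
move=> s_uniq s_size; apply: inj_card_bij; last by rewrite card_ord.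
by move=> i j /eqP; rewrite nth_uniq ?s_size // => /eqP/val_inj.
Qed.

(** * Structure of connected graphs *)

Section Connected.
Variable G : sgraph.
Hypothesis G_conn : connected_graph G.

(** If no edge left [S], then [S] would be closed under adjacency, hence under connectedness, and
    [y] could not be reached from [x]. *)
Lemma connected_boundary (S : {set G}) x y : x \in S -> y \notin S ->
  exists2 s, s \in S & exists2 w, w \notin S & adj s w.
Proof.
move=> xS yS.
have [/exists_inP[s sS /exists_inP[w wS sw]]|noex] :=
  boolP [exists s in S, [exists w in ~: S, adj s w]].
  by exists s => //; exists w => //; rewrite inE in wS.
have S_closed : closed (@adj G) S.
  apply: intro_closed; first exact/sym_connect_sym/adj_sym.
  move=> s w sw sS; apply: contraNT noex => wS.
  by apply/exists_inP; exists s => //; apply/exists_inP; exists w; rewrite ?inE.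
have /forallP/(_ x)/forallP/(_ y) xy := G_conn.
by have := closed_connect S_closed xy; rewrite xS (negbTE yS).
Qed.

Lemma deg_gt0 (x : G) : 1 < #|G| -> 0 < deg x.
Proof.
move=> G1; have [|y yx] := @exists_notin _ [set x]; first by rewrite cards1.
have [_ /set1P-> [w _ xw]] := connected_boundary (set11 x) yx.
by rewrite card_gt0; apply/set0Pn; exists w; rewrite inE.
Qed.

Lemma sum_degE : \sum_(x : G) deg x = #|[set p : G * G | adj p.1 p.2]|.
Proof.
rewrite -sum1_card (eq_bigl (fun p : G * G => predT p.1 && adj p.1 p.2)).
  rewrite -(pair_big_dep predT (@adj G) (fun _ _ => 1)) /=.
  by apply: eq_bigr => x _; rewrite /deg -sum1_card; apply: eq_bigl => y; rewrite inE.
by move=> p; rewrite inE.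
Qed.

(* Growing a vertex set one boundary vertex at a time gains two ordered
   adjacent pairs at each step. *)
Lemma sum_deg_geq : #|G|.-1.*2 <= \sum_(x : G) deg x.
Proof.
rewrite sum_degE; case: (posnP #|G|) => [->//|G_gt0].
have /card_gt0P[r _] := G_gt0.
pose pairs (S : {set G}) :=
  [set p : G * G | [&& adj p.1 p.2, p.1 \in S & p.2 \in S]].
have grow k : k < #|G| ->
    exists S : {set G}, [/\ r \in S, #|S| = k.+1 & k.*2 <= #|pairs S|].
  elim: k => [_|k IHk kG]; first by exists [set r]; rewrite set11 cards1.
  have [S [rS cS pS]] := IHk (ltnW kG).
  have [|y yS] := @exists_notin _ S; first by rewrite cS.
  have [s sS [w wS sw]] := connected_boundary rS yS.
  exists (w |: S); rewrite !inE rS orbT cardsU1 wS cS; split=> //.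
  have sub : (s, w) |: ((w, s) |: pairs S) \subset pairs (w |: S).
    apply/subsetP => -[a b]; rewrite !inE /= !xpair_eqE.
    case/or3P => [/andP[/eqP-> /eqP->]|/andP[/eqP-> /eqP->]|/and3P[-> -> ->]].
    - by rewrite sw sS eqxx orbT.
    - by rewrite adj_sym sw sS eqxx orbT.
    - by rewrite !orbT.
  apply: leq_trans (subset_leq_card sub).
  have sNw : s != w by apply: contraNneq wS => <-.
  rewrite !cardsU1 !inE /= !xpair_eqE (negbTE sNw) (negbTE wS) !andbF /=.
  by rewrite doubleS !add1n !ltnS.
have [|S [_ _ /leq_trans]] := grow #|G|.-1; first by rewrite ltn_predL.
apply; apply/subset_leq_card/subsetP => p.
by rewrite !inE => /and3P[].
Qed.

(** The only neighbour [w] of a leaf [x] other than [c] must be [c]: otherwise [w] is a leaf too,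
    its only neighbour is [x], and no edge leaves the set of [x] and [w], which misses [c]. *)
Lemma leaves_star_adj (c : G) : (forall x, x != c -> deg x = 1) ->
  forall x y, adj x y = ((x == c) != (y == c)).
Proof.
move=> leaf.
have leaf_adj x y : x != c -> adj x y = (y == c).
  move=> xc; have /eqP/cards1P[w Nx] := leaf x xc.
  have adj_x z : adj x z = (z == w) by have /setP/(_ z) := Nx; rewrite !inE.
  rewrite adj_x; have [->//|wc] := eqVneq w c.
  have /eqP/cards1P[v Nw] := leaf w wc.
  have adj_w z : adj w z = (z == v) by have /setP/(_ z) := Nw; rewrite !inE.
  have /eqP xv : x == v by rewrite -adj_w adj_sym adj_x.
  have cS : c \notin [set x; w] by rewrite !inE !(eq_sym c) negb_or xc wc.
  have [s + [u + su]] := connected_boundary (set21 x w) cS.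
  rewrite !inE => /orP[]/eqP sE; rewrite sE ?adj_x ?adj_w -?xv in su;
    by rewrite su ?orbT.
move=> x y; have [->|xc] := eqVneq x c; last by rewrite leaf_adj //; case: eqP.
have [->|yc] := eqVneq y c; first by rewrite adj_irrefl.
by rewrite adj_sym leaf_adj ?eqxx.
Qed.

(** As long as a path misses a vertex, some edge leaves its vertex set. The degree bound forces that
    edge to start at an end of the path, which can therefore be extended. *)
Lemma exists_hamiltonian_path : (forall x : G, deg x <= 2) -> 0 < #|G| ->
  exists s : seq G, [/\ uniq s, size s = #|G| & sorted adj s].
Proof.
move=> deg2 G_gt0; have /card_gt0P[r _] := G_gt0.
suff grow k : k < #|G| ->
    exists s : seq G, [/\ uniq s, size s = k.+1 & sorted adj s].
  have [|s [? sE ?]] := grow #|G|.-1; first by rewrite ltn_predL.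
  by exists s; rewrite sE prednK.
elim: k => [_|k IHk kG]; first by exists [:: r].
have [s [s_uniq s_size s_path]] := IHk (ltnW kG).
have [|y ys] := @exists_notin _ [set:: s].
  by rewrite cardsE (card_uniqP s_uniq) s_size.
have [x xs] : exists x, x \in [set:: s].
  by case: s s_size {s_uniq s_path ys} => // x s _; exists x; rewrite inE mem_head.
have [v + [w + vw]] := connected_boundary xs ys.
rewrite !inE => vs ws.
case/splitPr: vs s_uniq s_size s_path ws {ys xs} => p q.
(* The vertex [v] is the first of the path (prepend [w]), the last (append [w]), or lies between [a]
   and [b]. The last case is impossible, as [a], [b] and [w] would be three distinct neighbours of
   [v]. *)
case: (lastP p) => [|{}p a].
  move=> s_uniq s_size s_path ws; exists (w :: v :: q).
  by rewrite cons_uniq ws s_uniq /= adj_sym vw -s_size; split.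
case: q => [|b q].
  move=> s_uniq s_size s_path ws; exists (rcons (rcons (rcons p a) v) w).
  rewrite cats1 in s_uniq s_size s_path ws.
  rewrite rcons_uniq ws s_uniq size_rcons s_size; split=> //.
  case: p s_path {s_uniq s_size ws} => [|c p] /= s_path; first by rewrite vw andbT.
  by rewrite rcons_path last_rcons vw andbT.
rewrite cat_rcons => s_uniq s_size s_path ws.
have /subseq_uniq/(_ s_uniq) : subseq [:: a; v; b] (p ++ [:: a, v, b & q]).
  by rewrite -[X in subseq X](cat0s); apply: cat_subseq; rewrite ?sub0seq //=
    !eqxx sub0seq.
rewrite /= !inE !negb_or => /andP[/andP[av ab] /andP[vb _]].
have /andP[av_adj vb_adj] : adj a v && adj v b.
  have /subseq_sorted := s_path.
  by case: p s_path {s_uniq s_size ws} => [|c p] /=;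
    rewrite ?cat_path /= => /and3P[] //; [move=> -> -> |move=> _ _ /and3P[-> ->]].
move: ws; rewrite !mem_cat !inE !negb_or => /and5P[_ wa wv wb _].
have : #|[set a; b; w]| <= deg v.
  apply/subset_leq_card/subsetP => z; rewrite !inE -orbA.
  by case/or3P => /eqP-> //; rewrite adj_sym.
rewrite -setUA !cardsU1 cards1 !inE negb_or ab !(eq_sym _ w) wa wb /=.
by move/leq_trans/(_ (deg2 v)).
Qed.

End Connected.

(** * Degrees in the path and the star *)

Lemma deg_path_graph n (i : path_graph n) :
  deg i = (0 < i) + (i.+1 < n).
Proof.
pose prev := [set j : 'I_n | j.+1 == i]; pose next := [set j : 'I_n | i.+1 == j].
rewrite /deg (_ : [set _ | _] = prev :|: next); last first.
  by apply/setP => j; rewrite !inE orbC.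
rewrite cardsU (_ : prev :&: next = set0) ?cards0 ?subn0; last first.
  by apply/setP => j; rewrite !inE; apply/negP; lia.
congr (_ + _).
- case: posnP => [i0|i0].
    by apply/eqP; rewrite cards_eq0; apply/eqP/setP => j; rewrite !inE i0.
  have lti : i.-1 < n by have := ltn_ord i; lia.
  apply/eqP/cards1P; exists (Ordinal lti); apply/setP => j.
  by rewrite !inE -val_eqE /=; lia.
- case: (ltnP i.+1 n) => [lti|lei].
    apply/eqP/cards1P; exists (Ordinal lti); apply/setP => j.
    by rewrite !inE -val_eqE /= eq_sym.
  apply/eqP; rewrite cards_eq0; apply/eqP/setP => j.
  by rewrite !inE; have := ltn_ord j; lia.
Qed.

Lemma sum_deg_path_graph n : \sum_(i : path_graph n) deg i = n.-1.*2.
Proof.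
case: n => [|n]; first by rewrite big_ord0.
rewrite (eq_bigr (fun i : 'I_n.+1 => (0 < i) + (i.+1 < n.+1))); last first.
  by move=> i _; rewrite deg_path_graph.
rewrite big_split /= -addnn; congr (_ + _).
  by rewrite big_ord_recl /= sum1_card card_ord.
rewrite big_ord_recr /= ltnn addn0 (eq_bigr (fun=> 1)) ?sum1_card ?card_ord //.
by move=> i _; rewrite ltnS ltn_ord.
Qed.

Lemma prod_deg_star_graph n : 1 < n -> \prod_(i : star_graph n) deg i = n.-1.
Proof.
case: n => [|n] // n1.
have deg0 : deg (ord0 : star_graph n.+1) = n.
  rewrite /deg (_ : [set _ | _] = [set~ ord0]) ?cardsC1 ?card_ord //.
  by apply/setP => j; rewrite !inE -!val_eqE /= /star_adj /=; case: (nat_of_ord j == 0).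
have deg1 i : deg (lift ord0 i : star_graph n.+1) = 1.
  apply/eqP/cards1P; exists ord0; apply/setP => j.
  by rewrite !inE -!val_eqE /= /star_adj /=; case: (nat_of_ord j == 0).
rewrite big_ord_recl deg0 big1 ?muln1 // => i _; exact: deg1.
Qed.

Lemma zagreb1E (G : sgraph) : zagreb1 G = (\prod_(x : G) deg x) ^ 2.
Proof. by rewrite -mulnn -big_split /=; apply: eq_bigr => x _; rewrite -mulnn. Qed.

(** * The two bounds and their cases of equality *)

Section Bounds.
Variable G : sgraph.
Hypotheses (G_conn : connected_graph G) (G_gt1 : 1 < #|G|).

Lemma sum_deg_pred : \sum_(x : G) deg x = #|G| + \sum_(x : G) (deg x).-1.
Proof.
rewrite -[X in _ = X + _]sum1_card -big_split /=; apply: eq_bigr => x _.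
by rewrite add1n prednK // deg_gt0.
Qed.

Lemma sum_pred_deg_geq : #|G| - 2 <= \sum_(x : G) (deg x).-1.
Proof.
by have := sum_deg_geq G_conn; rewrite sum_deg_pred; lia.
Qed.

Lemma prod_degE : \prod_(x : G) deg x = \prod_(x : G) (deg x).-1.+1.
Proof. by apply: eq_bigr => x _; rewrite prednK // deg_gt0. Qed.

Lemma prod_deg_geq : #|G|.-1 <= \prod_(x : G) deg x.
Proof.
rewrite prod_degE; have := sum_lt_prod_succ predT (fun x : G => (deg x).-1).
by have := sum_pred_deg_geq; rewrite /=; lia.
Qed.

Lemma prod_deg_eq_leaves : \prod_(x : G) deg x = #|G|.-1 ->
  exists c : G, forall x, x != c -> deg x = 1.
Proof.
move=> prodE.
have leaf1 (x y : G) : x != y -> 1 < deg x -> deg y = 1.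
  move=> xy dx; apply/eqP; rewrite eqn_leq deg_gt0 // andbT leqNgt.
  apply/negP => dy.
  have := @sum_succ_lt_prod_succ G (fun x => (deg x).-1) x y xy.
  by rewrite -prod_degE prodE; have := sum_pred_deg_geq; lia.
have [/existsP[c dc]|noc] := boolP [exists c : G, 1 < deg c].
  by exists c => x xc; apply: (leaf1 c); rewrite 1?eq_sym.
(* When no degree exceeds 1, every vertex is a leaf and any vertex can serve as [c]. *)
have /card_gt0P[c _] : 0 < #|G| by exact: ltnW.
exists c => x _; apply/eqP; rewrite eqn_leq deg_gt0 // andbT leqNgt.
by apply: contra noc => dx; apply/existsP; exists x.
Qed.

(** The exponent is kept as a sum over the vertices so that the comparison is made factor by factor,
    together with its equality condition. The bound on the degree sum enters afterwards. *)
Lemma zagreb2_leqif :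
  4 ^ (\sum_(x : G) (deg x).-1) <= zagreb2 G ?= iff
    [forall x : G, deg x <= 2].
Proof.
rewrite zagreb2E expn_sum.
have -> : [forall x : G, deg x <= 2] = \big[andb/true]_(x : G) (deg x <= 2).
  by rewrite big_andE.
have deg_pos (x : G) := deg_gt0 G_conn x G_gt1.
(* Positivity of [b] is carried along because the equality condition in [leqif_mul] also admits a
   zero product on the right, which has to be excluded. *)
pose K (a b : nat) (c : bool) := 0 < b /\ (a <= b ?= iff c).
suff [] : K (\prod_(x : G) 4 ^ (deg x).-1) (\prod_(x : G) deg x ^ deg x)
  (\big[andb/true]_(x : G) (deg x <= 2)) by [].
elim/big_rec3: _ => [|x c b a _ [b0 leab]]; first by split.
have b1 : 0 < deg x ^ deg x * b by rewrite muln_gt0 expn_gt0 deg_pos.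
split=> //; have := leqif_mul (expn4_leq_expnn (deg_pos x)) leab.
by rewrite eqn0Ngt b1.
Qed.

Lemma zagreb2_geq : 4 ^ (#|G| - 2) <= zagreb2 G.
Proof.
apply: leq_trans (zagreb2_leqif).1.
by rewrite leq_exp2l // sum_pred_deg_geq.
Qed.

(** The power of 4 whose exponent is the sum of the [(deg x).-1] lies between the two sides, so
    equality holds exactly when both intermediate inequalities are equalities. *)
Lemma zagreb2_eq :
  zagreb2 G = 4 ^ (#|G| - 2) <->
  (forall x : G, deg x <= 2) /\ \sum_(x : G) deg x = #|G|.-1.*2.
Proof.
have [le_z eq_z] := zagreb2_leqif; have le_s := sum_pred_deg_geq.
rewrite sum_deg_pred; split=> [zE|[deg2 sumE]].
  have sE : \sum_(x : G) (deg x).-1 = #|G| - 2.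
    by apply/eqP; rewrite eqn_leq le_s andbT -(@leq_exp2l 4) // -zE.
  split; last by rewrite sE; lia.
  by apply/forallP; rewrite -eq_z sE zE.
have /eqP <- : 4 ^ (\sum_(x : G) (deg x).-1) == zagreb2 G.
  by rewrite eq_z; apply/forallP.
by congr (4 ^ _); lia.
Qed.

Lemma prod_deg_eq_star :
  \prod_(x : G) deg x = #|G|.-1 <-> graph_iso G (star_graph #|G|).
Proof.
split=> [/prod_deg_eq_leaves[c /(leaves_star_adj G_conn) adjE]|]; last first.
  case=> f f_bij f_adj; rewrite -(prod_deg_star_graph G_gt1).
  rewrite [RHS](reindex f) /=; last exact: onW_bij.
  by apply: eq_bigr => x _; rewrite (deg_iso f_bij f_adj).
(* Listing [c] first places it at index 0, the centre of [star_graph]; the order of the leaves is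
   arbitrary. *)
apply: graph_iso_sym; pose s := c :: enum (predC1 c).
have s_uniq : uniq s by rewrite /= mem_enum !inE eqxx enum_uniq.
have s_size : size s = #|G| by rewrite /= -cardE cardC1 prednK // ltnW.
exists (fun i : 'I_#|G| => nth c s i); first exact: nth_bij.
have nth_c (i : 'I_#|G|) : (nth c s i == c) = (i == 0 :> nat).
  by rewrite -[c in _ == c]/(nth c s 0) nth_uniq // s_size.
by move=> i j; rewrite adjE !nth_c.
Qed.

Lemma zagreb2_eq_path :
  zagreb2 G = 4 ^ (#|G| - 2) <-> graph_iso G (path_graph #|G|).
Proof.
split=> [/zagreb2_eq[deg2 sumE]|[f f_bij f_adj]]; last first.
  have degE x := deg_iso f_bij f_adj x.
  apply/zagreb2_eq; split=> [x|].
    by rewrite -degE deg_path_graph; case: (0 < _); case: (_ < _).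
  rewrite -(sum_deg_path_graph #|G|) [RHS](reindex f) /=; last exact: onW_bij.
  by apply: eq_bigr => x _; rewrite degE.
have [//|s [s_uniq s_size s_path]] := exists_hamiltonian_path G_conn deg2.
  exact: ltnW.
have [r _] : exists r : G, r \in G by apply/card_gt0P/ltnW.
(* Numbering the vertices along the Hamiltonian path sends edges of [path_graph] to edges of [G].
   Both degree sums are [#|G|.-1.*2], so [bij_hom_sum_deg] yields an isomorphism. *)
apply: graph_iso_sym; pose f (i : path_graph #|G|) := nth r s i.
have f_bij : bijective f by apply: nth_bij.
exists f => //; apply: bij_hom_sum_deg => //; last first.
  by rewrite sumE sum_deg_path_graph.
have step (i j : 'I_#|G|) : i.+1 == j -> adj (f i) (f j).
  by move/eqP=> ij; rewrite /f -ij; apply/sortedP; rewrite // s_size ij.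
by move=> i j /orP[/step //|/step]; rewrite adj_sym.
Qed.

End Bounds.

Theorem theorem4p7 (n k : nat) (G : sgraph)
    (hk : 1 <= k <= n - 1) (hG : Enk n k G) :
  [/\ (n - 1) ^ 2 <= zagreb1 G,
      4 ^ (n - 2) <= zagreb2 G,
      zagreb1 G = (n - 1) ^ 2 <-> graph_iso G (star_graph n) &
      zagreb2 G = 4 ^ (n - 2) <-> graph_iso G (path_graph n)].
Proof.
case: hG => G_conn Gn _ _; have n_gt1 : 1 < #|G| by rewrite Gn; lia.
rewrite -{}Gn subn1 zagreb1E; split.
- by rewrite leq_exp2r // prod_deg_geq.
- exact: zagreb2_geq.
- rewrite -prod_deg_eq_star //; split=> [/eqP|->//].
  by rewrite eqn_exp2r // => /eqP.
- exact: zagreb2_eq_path.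
Qed.
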